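(* Let $L$ be a nilpotent symplectic alternating algebra of dimension $2n\geq 8$ given by some nilpotent presentation $\mathcal{P}$ with respect to a standard basis $x_1,y_1,\ldots,x_n,y_n$. Then $L$ is of maximal class (class $2n-3$) if and only if $x_{n-2}y_{n-1},\ x_{n-3}y_{n-2},\ \ldots,\ x_2y_3$ are all non-zero and $x_1y_2,\ y_1y_2$ are linearly independent.
   Context: A symplectic alternating algebra (SAA) over a field $\mathbb{F}$ is a finite-dimensional vector space $L$ over $\mathbb{F}$ with a non-degenerate alternating bilinear form $(\ ,\ )$ and a bilinear product $\cdot$ satisfying $u\cdot u=0$ for all $u$ and $(u\cdot v,w)=(v\cdot w,u)$ for all $u,v,w\in L$. No associativity or Jacobi identity is assumed. The map $(u,v,w)\mapsto(uv,w)$ is then an alternating trilinear form. A standard basis is a basis $x_1,y_1,\ldots,x_n,y_n$ with $(x_i,x_j)=(y_i,y_j)=0$ and $(x_i,y_j)=\delta_{ij}$ for all $i,j$. A nilpotent presentation of $L$ with respect to a standard basis is data $\mathcal{P}:\ (x_iy_j,y_k)=\alpha_{ijk},\ (y_iy_j,y_k)=\beta_{ijk}$, $1\leq i<j<k\leq n$, with $\alpha_{ijk},\beta_{ijk}\in\mathbb{F}$, where $(uv,w)=0$ for all triples $u,v,w$ of basis elements that are not, up to reordering, of the form $x_i,y_j,y_k$ or $y_i,y_j,y_k$ with $i<j<k$. $L^1=L$, and $L^{m+1}=L^mL$ is the span of all products $uv$ with $u\in L^m$, $v\in L$. $L$ is nilpotent if $L^{m+1}=\{0\}$ for some $m\geq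 0$, and the smallest such $m$ is its (nilpotence) class. The class of a nilpotent SAA of dimension $2n\geq 6$ is at most $2n-3$; $L$ is of maximal class if its class equals $2n-3$. *)

(* Defs.v *)
From mathcomp Require Import all_boot all_order all_algebra.
Set Implicit Arguments.
Unset Strict Implicit.
Unset Printing Implicit Defensive.
Import GRing.Theory.
Local Open Scope ring_scope.

Section SAA.

Variables (F : fieldType) (L : vectType F).
Variables (form : {biscalar L}) (mul : {bilinear L -> L -> L}).

Record is_SAA : Prop := {
  form_alt : forall u, form u u = 0;
  form_nondeg : forall u, (forall v, form u v = 0) -> u = 0;
  mul_alt : forall u, mul u u = 0;
  form_mul_cycle : forall u v w, form (mul u v) w = form (mul v w) u
}.

(* The span of all products of elements of U and V.  By bilinearity bases
   suffice; prod_spaceP states that this is the smallest subspace containing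
   all the products. *)
Definition prod_space (U V : {vspace L}) : {vspace L} :=
  <<[seq mul u v | u <- vbasis U, v <- vbasis V]>>%VS.

Lemma mem_prod_space (U V : {vspace L}) :
  {in U & V, forall u v, mul u v \in prod_space U V}.
Proof.
move=> u v /coord_vbasis-> /coord_vbasis->.
rewrite linear_sumlz; apply: memv_suml => i _.
rewrite linear_sumr; apply: memv_suml => j _.
rewrite linearZr_LR linearZl_LR /= !memvZ // memv_span //.
by apply/allpairsP; exists ((vbasis U)`_i, (vbasis V)`_j); rewrite !memt_nth.
Qed.

Lemma prod_spaceP (U V W : {vspace L}) :
  reflect {in U & V, forall u v, mul u v \in W} (prod_space U V <= W)%VS.
Proof.
apply: (iffP idP) => [sUVW u v Uu Vv | sUVW].
  by rewrite (subvP sUVW) ?mem_prod_space.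
apply/span_subvP=> _ /allpairsP[[u v] /= [Uu Vv ->]].
by rewrite sUVW ?vbasis_mem.
Qed.

(* The powers are indexed from 1: L^1 = L, and lower_power 0 is L by
   convention and never used. *)
Definition lower_power (m : nat) : {vspace L} :=
  iter m.-1 (fun U => prod_space U fullv) fullv.

Definition SAA_nilpotent : Prop := exists m, lower_power m.+1 = 0%VS.

Definition SAA_class (c : nat) : Prop :=
  lower_power c.+1 = 0%VS /\
  forall m, lower_power m.+1 = 0%VS -> (c <= m)%N.

(* The families x, y : nat -> L are only meaningful at the indices 1, ..., n. *)
Definition std_seq (n : nat) (x y : nat -> L) : seq L :=
  flatten [seq [:: x i; y i] | i <- iota 1 n].

Definition standard_basis (n : nat) (x y : nat -> L) : Prop :=
  basis_of fullv (std_seq n x y) /\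
  forall i j, (1 <= i <= n)%N -> (1 <= j <= n)%N ->
    [/\ form (x i) (x j) = 0, form (y i) (y j) = 0
      & form (x i) (y j) = (i == j)%:R].

Definition nilpotent_presentation (n : nat) (x y : nat -> L)
    (alpha beta : nat -> nat -> nat -> F) : Prop :=
  (forall i j k, (1 <= i)%N -> (i < j)%N -> (j < k)%N -> (k <= n)%N ->
     form (mul (x i) (y j)) (y k) = alpha i j k /\
     form (mul (y i) (y j)) (y k) = beta i j k) /\
  (forall u v w, u \in std_seq n x y -> v \in std_seq n x y ->
     w \in std_seq n x y ->
     ~ (exists i j k, [/\ (1 <= i)%N, (i < j)%N, (j < k)%N, (k <= n)%N
          & perm_eq [:: u; v; w] [:: x i; y j; y k] \/
            perm_eq [:: u; v; w] [:: y i; y j; y k]]) ->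
     form (mul u v) w = 0).

End SAA.

(* Main.v *)
Require Import Defs.
From mathcomp Require Import all_boot all_order all_algebra.
From mathcomp Require Import zify.

(** Give the basis vectors levels 1, ..., 2n-3 so that a product of two of them
    vanishes when their levels add up to at most 2n-2:
[[
      level   1             2        ...  n-2   n-1        n    ...  2n-4     2n-3
      vectors x_n, x_(n-1)  x_(n-2)  ...  x_2   x_1, y_1   y_2  ...  y_(n-2)  y_(n-1), y_n
]]
    Dual basis vectors have levels adding up to 2n-2, so multiplication lowers
    the filtration by level ([mul_std_eq0]).  Consequently every u in L^m is
    orthogonal to all basis vectors of level below m
    ([lower_power_kills]), whence L^(2n-2) = 0, and the class is 2n-3 exactly
    when L^(2n-3) is nonzero ([max_classE]).

    The class is maximal when no step of the descent can be skipped.  Since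
    (u v, b) = (b u, v), the next power pairs trivially with b exactly when b
    annihilates the current one.  For b of level m+1 and u in L^m, every
    term of b u but those on the level opposite to m vanishes for degree
    reasons ([leading_term]): up to sign, b u is
[[
      x_i u     = (u, x_(i+1)) x_i y_(i+1)              for m = n-i-1 > 1,
      y_2 u     = (u, x_1) y_1 y_2 - (u, y_1) x_1 y_2   for m = n-1,
      y_(i+1) u = (u, y_i) x_i y_(i+1)                  for m = n-2+i, i > 1.
]]
    So if the listed products are nonzero and x_1 y_2, y_1 y_2 are independent,
    these formulas produce, for each m in turn, an element of L^m that pairs
    nontrivially with a basis vector of level m ([detect_x], [detect_y]).

    Conversely, if x_i y_(i+1) = 0 then L^(n-i) is orthogonal to level n-i
    as well; the descent has gained one step, which it keeps, and
    L^(2n-3) = 0 ([lower_power_jump]).  If p x_1 y_2 + q y_1 y_2 = 0 is a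
    nontrivial relation, then L^(n-1) is orthogonal to p x_1 + q y_1, the
    formula for y_2 u becomes a multiple of that relation, and the step
    is gained at level n. *)

Set Implicit Arguments.
Unset Strict Implicit.
Unset Printing Implicit Defensive.
Import GRing.Theory.
Local Open Scope ring_scope.

(** * Two vectors and their linear relations *)

Lemma free_pairP (F : fieldType) (L : vectType F) (a b : L) :
  reflect (forall p q : F, p *: a + q *: b = 0 -> p = 0 /\ q = 0)
          (free [:: a; b]).
Proof.
apply: (iffP idP) => [/(@freeP _ _ 2 [tuple a; b]) free_ab p q pq0 | indep].
  have k0 := free_ab (fun i => if i == ord0 then p else q).
  rewrite !big_ord_recl big_ord0 addr0 /= in k0.
  by split; [exact: (k0 pq0 ord0) | exact: (k0 pq0 (lift ord0 ord0))].
rewrite free_cons seq1_free span_seq1; apply/andP; split; apply/negP.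
  case/vlineP=> k ak; have [] := indep 1 (- k); last first.
    by move/eqP; rewrite oner_eq0.
  by rewrite scale1r scaleNr ak subrr.
move/eqP=> b0; have [] := indep 0 1; last by move=> _ /eqP; rewrite oner_eq0.
by rewrite scale0r b0 scaler0 addr0.
Qed.

(** Both (u, v) and (a, b) solve the linear equation with coefficients (p, q),
    whose solutions are the multiples of (q, - p), so their determinant vanishes. *)
Lemma cross_eq0 (F : fieldType) (L : vectType F) (p q a b : F) (u v : L) :
  (p != 0) || (q != 0) -> p *: u + q *: v = 0 -> p * a + q * b = 0 ->
  a *: v = b *: u.
Proof.
move=> /orP pq /eqP; rewrite addr_eq0 => /eqP pu /eqP.
rewrite addr_eq0 => /eqP pa; case: pq => nz; apply: (scalerI nz).
  by rewrite !scalerA pa [p * b]mulrC -(scalerA b) pu scalerN scalerA scaleNr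
    [q * b]mulrC.
have qv : q *: v = - (p *: u) by rewrite pu opprK.
have qb : q * b = - (p * a) by rewrite pa opprK.
by rewrite !scalerA qb [q * a]mulrC -(scalerA a) qv scalerN scalerA scaleNr
  [p * a]mulrC.
Qed.

Section NilpotentPresentation.

Variables (F : fieldType) (L : vectType F).
Variables (form : {biscalar L}) (mul : {bilinear L -> L -> L}).
Variables (n : nat) (x y : nat -> L) (alpha beta : nat -> nat -> nat -> F).
Hypotheses (hL : is_SAA form mul) (n_ge4 : (4 <= n)%N).
Hypotheses (hxy : standard_basis form n x y)
  (hP : nilpotent_presentation form mul n x y alpha beta).

(** * Symmetries of the trilinear form *)

Lemma form_antisym u v : form u v = - form v u.
Proof.
apply/eqP; rewrite -addr_eq0; apply/eqP; have := form_alt hL (u + v).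
by rewrite linearDl !linearDr /= !(form_alt hL) add0r addr0.
Qed.

Lemma mul_antisym u v : mul u v = - mul v u.
Proof.
apply/eqP; rewrite -addr_eq0; apply/eqP; have := mul_alt hL (u + v).
by rewrite linearDl !linearDr /= !(mul_alt hL) add0r addr0.
Qed.

Lemma form_mulC u v w : form (mul u v) w = form (mul w u) v.
Proof. by rewrite -(form_mul_cycle hL). Qed.

Lemma form_mul_swap u v w : form (mul u v) w = - form (mul u w) v.
Proof. by rewrite form_mulC mul_antisym linearNl. Qed.

Lemma form_eq0 u : (forall v, form v u = 0) -> u = 0.
Proof.
by move=> u0; apply: (form_nondeg hL) => v; rewrite form_antisym u0 oppr0.
Qed.

(** * Coordinates in the standard basis *)

(** The standard basis as one family, so that a statement can range over both
    kinds of basis vector; ~~ s names the vector dual to the one named by s. *)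
Definition std_vec (s : bool) (i : nat) : L := if s then x i else y i.

Lemma form_std s i t j : (1 <= i <= n)%N -> (1 <= j <= n)%N ->
  form (std_vec s i) (std_vec t j) = ((-1) ^+ ~~ s) *+ ((s != t) && (i == j)).
Proof.
move=> hi hj; have [xx yy xy] := hxy.2 i j hi hj.
case: s t => [] [] //=.
by rewrite form_antisym; case: (hxy.2 j i hj hi) => _ _ -> /=; rewrite eq_sym -mulNrn.
Qed.

Lemma std_eqE s i t j : (1 <= i <= n)%N -> (1 <= j <= n)%N ->
  (std_vec s i == std_vec t j) = (s == t) && (i == j).
Proof.
move=> hi hj; apply/eqP/andP => [eq_e | [/eqP-> /eqP->] //].
have : form (std_vec s i) (std_vec (~~ s) i) != 0.
  by rewrite form_std // eqxx; case: (s); rewrite /= ?oppr_eq0 oner_eq0.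
rewrite eq_e form_std //.
case: (boolP (_ && _)) => [/andP[ts /eqP->] _|_]; last by rewrite mulr0n eqxx.
by move: ts; case: (s) (t) => [] [].
Qed.

Lemma mem_std_seq s i : (1 <= i <= n)%N -> std_vec s i \in std_seq n x y.
Proof.
move=> hi; apply/flattenP; exists [:: x i; y i]; last first.
  by rewrite !inE /std_vec; case: s; rewrite eqxx ?orbT.
by apply/mapP; exists i; rewrite // mem_iota; lia.
Qed.

Lemma std_seqP v : v \in std_seq n x y ->
  exists s i, (1 <= i <= n)%N /\ v = std_vec s i.
Proof.
case/flattenP=> b /mapP[i]; rewrite mem_iota => hi ->.
by rewrite !inE => /orP[] /eqP->; [exists true | exists false]; exists i; split=> //; lia.
Qed.

Lemma span_form_eq0 (X : seq L) u v : (forall b, b \in X -> form b u = 0) ->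
  v \in <<X>>%VS -> form v u = 0.
Proof.
move=> X0 /(@coord_span _ _ _ (in_tuple X))->.
rewrite linear_sumlz big1 // => i _.
by rewrite linearZl_LR /= X0 ?mulr0 // mem_nth.
Qed.

Lemma std_detect u : (forall s i, (1 <= i <= n)%N -> form u (std_vec s i) = 0) -> u = 0.
Proof.
move=> u0; apply: form_eq0 => v; apply: (@span_form_eq0 (std_seq n x y)).
  by move=> b /std_seqP[s [i [hi ->]]]; rewrite form_antisym u0 ?oppr0.
by rewrite (span_basis hxy.1) memvf.
Qed.

Lemma std_expand u :
  u = \sum_(1 <= i < n.+1) (form u (y i) *: x i - form u (x i) *: y i).
Proof.
apply/eqP; rewrite -subr_eq0; apply/eqP/std_detect => t j hj.
rewrite linearBl linear_sumlz /= (bigD1_seq j) ?mem_index_iota ?iota_uniq //=.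
rewrite big_seq_cond big1 => [|i]; last first.
  rewrite mem_index_iota => /andP[hi ne].
  rewrite linearBl !linearZl_LR /= (form_std true) ?(form_std false); try lia.
  by rewrite (negPf ne) !andbF !mulr0 subr0.
rewrite linearBl !linearZl_LR /= (form_std true) ?(form_std false) // eqxx.
by case: t => /=; rewrite ?mulr0 ?mulr1 ?mulrN1 ?opprK ?subr0 ?add0r ?addr0 subrr.
Qed.

(** * The filtration by levels *)

(** The truncations are forced by x_(n-1) and x_n both annihilating L: they share
    the lowest level, and dually y_(n-1) and y_n share the highest.  Counting up
    from x_1 and from y_1 starts at the same level n-1, because y_1 L has no
    component along x_1. *)
Definition level (s : bool) (i : nat) : nat :=
  if s then maxn 1 (n - i) else minn (2 * n - 3) (n - 2 + i).

Lemma level_dual s i : (1 <= i <= n)%N ->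
  (level s i + level (~~ s) i = 2 * n - 2)%N.
Proof. by rewrite /level; case: s => /=; lia. Qed.

(** Only here does the shape of the presentation enter: in a triple on which the
    form may be nonzero, any two of the three vectors have levels adding up to
    at least 2n-1. *)
Lemma mul_std_eq0 s i t j : (1 <= i <= n)%N -> (1 <= j <= n)%N ->
  (level s i + level t j <= 2 * n - 2)%N -> mul (std_vec s i) (std_vec t j) = 0.
Proof.
move=> hi hj lev; case: (eqVneq (std_vec s i) (std_vec t j)) => [->|ne].
  exact: mul_alt hL _.
apply: std_detect => r k hk; apply: hP.2; rewrite ?mem_std_seq //.
rewrite std_eqE // in ne.
move=> [i' [j' [k' [hi' ij jk hk' perm]]]].
have {perm} [a perm] : exists a, perm_eq [:: std_vec s i; std_vec t j; std_vec r k]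
    [:: std_vec a i'; std_vec false j'; std_vec false k'].
  by case: perm; [exists true | exists false].
have := perm_mem perm (std_vec s i); have := perm_mem perm (std_vec t j).
rewrite !inE !eqxx !orbT !std_eqE //; try lia.
move: lev ne; rewrite /level; case: s t a {perm} => [] [] [] /=; lia.
Qed.

(** By [level_dual] these are the vectors in the span of the basis vectors of
    level at most 2n-2-m. *)
Definition kills_below u m :=
  forall s i, (1 <= i <= n)%N -> (level s i < m)%N -> form u (std_vec s i) = 0.

Lemma kills_term_eq0 u m s i t k : kills_below u m ->
  (1 <= i <= n)%N -> (1 <= k <= n)%N ->
  (level (~~ t) k < m)%N || (level s i <= level (~~ t) k)%N ->
  form u (std_vec (~~ t) k) *: mul (std_vec s i) (std_vec t k) = 0.
Proof.
move=> um hi hk /orP[lt|le]; first by rewrite um // scale0r.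
by rewrite mul_std_eq0 ?scaler0 //; have := level_dual t hk; lia.
Qed.

Lemma kills_mul u m s i : kills_below u m -> (1 <= i <= n)%N ->
  (level s i <= m)%N -> mul (std_vec s i) u = 0.
Proof.
move=> um hi lev; rewrite (std_expand u) linear_sumr big_seq_cond big1 // => k.
rewrite mem_index_iota andbT => hk.
have van t := @kills_term_eq0 u m s i t k um hi hk.
by rewrite linearBr !linearZr_LR /= (van true) ?(van false) ?subr0 //; lia.
Qed.

(** One level above the reach of [kills_mul], the coordinates of u on the level
    opposite to m are the only ones that survive multiplication.  Every level m
    other than 1 and 2n-3 involves a single index j; level n-1 consists of both
    x_1 and y_1, which is why both terms are kept. *)
Lemma leading_term u m s i j : kills_below u m ->
  (1 <= i <= n)%N -> (level s i <= m.+1)%N -> (1 <= j <= n)%N ->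
  (forall t k, (1 <= k <= n)%N -> level t k = m -> k = j) ->
  mul (std_vec s i) u =
    form u (y j) *: mul (std_vec s i) (x j)
    - form u (x j) *: mul (std_vec s i) (y j).
Proof.
move=> um hi lev hj uniq_j; rewrite {1}(std_expand u) linear_sumr /=.
rewrite (bigD1_seq j) ?mem_index_iota ?iota_uniq //= big_seq_cond big1 => [|k].
  by rewrite addr0 linearBr !linearZr_LR.
rewrite mem_index_iota => /andP[hk ne].
have lev_k t : level t k <> m by move/(uniq_j _ _ hk)/eqP; rewrite (negPf ne).
have van t := @kills_term_eq0 u m s i t k um hi hk.
rewrite linearBr !linearZr_LR /= (van true) ?(van false) ?subr0 //.
  by have := lev_k (~~ false); lia.
by have := lev_k (~~ true); lia.
Qed.

(** * The lower powers descend through the filtration *)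

Local Notation Lp := (lower_power mul).

Lemma lower_powerS m : (0 < m)%N -> Lp m.+1 = prod_space mul (Lp m) fullv.
Proof. by case: m. Qed.

Lemma mul_lower_power m u v : (0 < m)%N -> u \in Lp m -> mul u v \in Lp m.+1.
Proof. by move=> m0 hu; rewrite lower_powerS // mem_prod_space ?memvf. Qed.

(** Induction along the powers: as (u v, w) = (w u, v), pairing trivially with w
    one power further is implied by annihilation by w. *)
Lemma lower_power_form_eq0 m w : (0 < m)%N ->
  (forall u v, u \in Lp m -> form (mul w u) v = 0) ->
  forall u, u \in Lp m.+1 -> form u w = 0.
Proof.
move=> m0 w0 u; rewrite lower_powerS //; apply: span_form_eq0 => b.
by case/allpairsP=> [[u1 v] /= [/vbasis_mem hu _ ->]]; rewrite form_mulC w0.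
Qed.

Lemma kills_below_step m r : (0 < m)%N ->
  (forall u, u \in Lp m -> kills_below u r) ->
  forall u, u \in Lp m.+1 -> kills_below u r.+1.
Proof.
move=> m0 mr u hu s i hi lev; apply: lower_power_form_eq0 hu => // u1 v /mr hu1.
by rewrite (kills_mul hu1) // linear0l.
Qed.

(** Any excess of r over m is kept by all later powers. *)
Lemma kills_below_iter m r d : (0 < m)%N ->
  (forall u, u \in Lp m -> kills_below u r) ->
  forall u, u \in Lp (m + d) -> kills_below u (r + d).
Proof.
move=> m0 mr; elim: d => [|d IHd]; first by rewrite !addn0.
by rewrite !addnS; apply: kills_below_step => //; lia.
Qed.

Lemma lower_power_kills m u : (0 < m)%N -> u \in Lp m -> kills_below u m.
Proof.
case: m => // m _; rewrite -add1n; apply: kills_below_iter => // v _ s i hi.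
by rewrite /level; case: s; lia.
Qed.

Lemma kills_all u : kills_below u (2 * n - 2) -> u = 0.
Proof.
move=> u0; apply: std_detect => s i hi; apply: u0 => //.
by rewrite /level; case: s; lia.
Qed.

(** All levels are below 2n-2, so L^(2n-2) = 0 holds unconditionally. *)
Lemma max_classE : SAA_class mul (2 * n - 3) <-> Lp (2 * n - 3) <> 0%VS.
Proof.
split=> [[_ minc] L0 | Lne0].
  have := minc (2 * n - 4)%N; have -> : (2 * n - 4).+1 = (2 * n - 3)%N by lia.
  by move/(_ L0); lia.
split=> [|m Lm0].
  have -> : (2 * n - 3).+1 = (2 * n - 2)%N by lia.
  apply/eqP; rewrite -subv0; apply/subvP => u /lower_power_kills um.
  by rewrite (kills_all (um _)) ?mem0v //; lia.
rewrite leqNgt; apply/negP => lt_m; apply: Lne0.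
(* A vanishing power makes all the later ones vanish. *)
have -> : (2 * n - 3 = m.+1 + (2 * n - 4 - m))%N by lia.
elim: (2 * n - 4 - m)%N => [|d IHd]; first by rewrite addn0.
rewrite addnS lower_powerS // IHd; apply/eqP; rewrite -subv0.
by apply/prod_spaceP => u v; rewrite memv0 => /eqP-> _; rewrite linear0l mem0v.
Qed.

(** * Maximal class forces the products to be nonzero *)

(** If the only basis vector of level m+1 annihilates L^m, then L^(m+1) kills
    one more level than it must, and this gain exhausts the 2n-3 levels one
    power early. *)
Lemma lower_power_jump m s i : (0 < m)%N -> (m.+1 <= 2 * n - 3)%N ->
  (forall t k, (1 <= k <= n)%N -> level t k = m.+1 -> t = s /\ k = i) ->
  (forall u, u \in Lp m -> mul (std_vec s i) u = 0) ->
  Lp (2 * n - 3) = 0%VS.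
Proof.
move=> m0 le_m uniq_si si0.
have jump u : u \in Lp m.+1 -> kills_below u m.+2.
  move=> hu t k hk; rewrite ltnS leq_eqVlt => /orP[/eqP lev|]; last first.
    exact: lower_power_kills hu _ _ hk.
  have [-> ->] := uniq_si t k hk lev.
  by apply: lower_power_form_eq0 hu => // u1 v /si0 ->; rewrite linear0l.
apply/eqP; rewrite -subv0; apply/subvP => u.
have -> : (2 * n - 3 = m.+1 + (2 * n - 4 - m))%N by lia.
move/(kills_below_iter (ltn0Sn m) jump) => u0.
have e : (m.+2 + (2 * n - 4 - m) = 2 * n - 2)%N by lia.
by rewrite e in u0; rewrite (kills_all u0) mem0v.
Qed.

(** For i < n-2 this is read off the leading term.  For i = n-2 level 1
    contains both x_(n-1) and x_n; there x_i is seen to annihilate L, because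
    (x_i y_n, y_(n-1)) = - (x_i y_(n-1), y_n) and no other coordinate of x_i y_n
    can be nonzero. *)
Lemma x_mul_eq0 i u : (2 <= i <= n - 2)%N -> mul (x i) (y i.+1) = 0 ->
  u \in Lp (n - i.+1) -> mul (x i) u = 0.
Proof.
move=> hi xy0 hu; case: (ltnP i (n - 2)) => [lt_i|ge_i].
  have um : kills_below u (n - i.+1) by apply: lower_power_kills => //; lia.
  rewrite (@leading_term _ _ true i i.+1 um) ?xy0; try by rewrite /level; lia.
    by rewrite scaler0 subr0 (@mul_std_eq0 true i true i.+1) ?scaler0 //;
      rewrite /level; lia.
  by move=> t k hk; rewrite /level; case: t; lia.
have {hi ge_i} i_eq : i = (n - 2)%N by lia.
have low t k : (1 <= k <= n)%N -> (t || (k < n - 1))%N ->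
    mul (x i) (std_vec t k) = 0.
  move=> hk tk; apply: (@mul_std_eq0 true i t k) => //; first by lia.
  by move: tk; rewrite /level; case: t => /=; lia.
have prev k : (1 <= k < n)%N -> mul (x i) (y k) = 0.
  move=> hk; case: (ltnP k (n - 1)) => [lt|ge].
    by apply: (low false) => //; lia.
  by have -> : k = i.+1 by lia.
have last_y : mul (x i) (y n) = 0.
  apply: std_detect => -[] k hk; rewrite form_mul_swap.
    by rewrite (low true) // linear0l oppr0.
  case: (ltnP k n) => [lt|ge].
    by rewrite /= prev ?linear0l ?oppr0 //; lia.
  have -> : k = n by lia.
  by rewrite (form_mul_cycle hL) (mul_alt hL) linear0l oppr0.
rewrite (std_expand u) linear_sumr big_seq_cond big1 // => k.
rewrite mem_index_iota andbT => hk; rewrite linearBr !linearZr_LR /=.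
rewrite (low true k) //.
case: (ltnP k n) => [lt|ge]; first by rewrite prev ?scaler0 ?subr0 //; lia.
have -> : k = n by lia.
by rewrite last_y !scaler0 subr0.
Qed.

Lemma x_mul_neq0 i : (2 <= i <= n - 2)%N -> Lp (2 * n - 3) <> 0%VS ->
  mul (x i) (y i.+1) != 0.
Proof.
move=> hi Lne0; apply/eqP => xy0; apply: Lne0.
apply: (@lower_power_jump (n - i.+1) true i); try lia.
  by move=> t k hk; rewrite /level; case: t; lia.
by move=> u; apply: x_mul_eq0.
Qed.

Lemma y2_mul u : u \in Lp (n - 1) ->
  mul (y 2) u = form u (x 1%N) *: mul (y 1%N) (y 2)
              - form u (y 1%N) *: mul (x 1%N) (y 2).
Proof.
move=> hu; have um : kills_below u (n - 1) by apply: lower_power_kills => //; lia.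
rewrite (@leading_term _ _ false 2 1 um) /=; try by rewrite /level; lia.
  by rewrite (mul_antisym (y 2)) (mul_antisym (y 2)) !scalerN opprK addrC.
by move=> t k hk; rewrite /level; case: t; lia.
Qed.

(** Both x_1 and y_1 sit on level n-1, so their products with u in L^(n-2) have
    leading terms with the same coefficient (u, x_2), and a relation
    between x_1 y_2 and y_1 y_2 passes to them. *)
Lemma xy1_mul p q u : p *: mul (x 1%N) (y 2) + q *: mul (y 1%N) (y 2) = 0 ->
  u \in Lp (n - 2) -> mul (p *: x 1%N + q *: y 1%N) u = 0.
Proof.
move=> pq0 hu.
have um : kills_below u (n - 2) by apply: lower_power_kills => //; lia.
have lead s : mul (std_vec s 1) u = - form u (x 2) *: mul (std_vec s 1) (y 2).
  rewrite (@leading_term _ _ s 1 2 um); try by rewrite /level; case: (s); lia.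
    rewrite (@mul_std_eq0 s 1 true 2) ?scaler0 ?sub0r ?scaleNr //; try lia.
    by rewrite /level; case: (s); lia.
  by move=> t k hk; rewrite /level; case: t; lia.
rewrite linearDl !linearZl_LR /= (lead true) (lead false) !scalerA.
by rewrite ![_ * - _]mulrC -!scalerA -scalerDr pq0 scaler0.
Qed.

(** A relation with coefficients (p, q) makes L^(n-1) orthogonal to
    p x_1 + q y_1; the coefficients in [y2_mul] are then proportional to the
    relation, so y_2 annihilates L^(n-1) and a level is gained. *)
Lemma xy1_mul_free : Lp (2 * n - 3) <> 0%VS ->
  free [:: mul (x 1%N) (y 2); mul (y 1%N) (y 2)].
Proof.
move=> Lne0; apply/free_pairP => p q pq0.
case: (boolP ((p != 0) || (q != 0))) => [pq|]; last first.
  by rewrite negb_or !negbK => /andP[/eqP-> /eqP->].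
case: Lne0; apply: (@lower_power_jump (n - 1) false 2); try lia.
  by move=> t k hk; rewrite /level; case: t; lia.
move=> u hu; rewrite y2_mul //.
have u_perp : form u (p *: x 1%N + q *: y 1%N) = 0.
  have n1 : (n - 1 = (n - 2).+1)%N by lia.
  rewrite n1 in hu; apply: lower_power_form_eq0 hu; first by lia.
  by move=> u1 v hu1; rewrite xy1_mul ?linear0l.
rewrite linearDr !linearZr_LR /= in u_perp.
by rewrite (cross_eq0 pq pq0 u_perp) subrr.
Qed.

(** * The products being nonzero forces maximal class *)

Lemma form_neq0_witness w : w != 0 -> exists v, form w v != 0.
Proof.
move=> w0.
have [|w_perp] := boolP [exists s : bool, [exists i : 'I_n.+1,
    (0 < i)%N && (form w (std_vec s i) != 0)]].
  by case/existsP=> s /existsP[i /andP[_]]; exists (std_vec s i).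
case/eqP: w0; apply: std_detect => s i hi; apply: contraNeq w_perp => wi.
have lt_i : (i < n.+1)%N by lia.
by apply/existsP; exists s; apply/existsP; exists (Ordinal lt_i); rewrite /= wi andbT; lia.
Qed.

(** The converse of [lower_power_form_eq0], by nondegeneracy of the form. *)
Lemma lower_power_extend m w u : (0 < m)%N -> u \in Lp m -> mul w u != 0 ->
  exists2 u', u' \in Lp m.+1 & form u' w != 0.
Proof.
move=> m0 hu /form_neq0_witness[v wuv].
by exists (mul u v); rewrite ?mul_lower_power // form_mulC.
Qed.

Section Sufficiency.

Hypothesis xy_neq0 :
  forall i, (2 <= i <= n - 2)%N -> mul (x i) (y i.+1) != 0.
Hypothesis free1 : free [:: mul (x 1%N) (y 2); mul (y 1%N) (y 2)].

Lemma xy_neq0_from1 i : (1 <= i <= n - 2)%N -> mul (x i) (y i.+1) != 0.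
Proof.
case: (ltnP 1 i) => [lt|ge] hi; first by apply: xy_neq0; lia.
have -> : i = 1%N by lia.
by apply: contraTneq free1 => ->; rewrite free_cons mem0v.
Qed.

(** The lower half of the levels, from x_(n-2) up to x_1.  The start is y_(n-1)
    rather than an arbitrary element pairing nontrivially with x_(n-1), since
    level 1 has two vectors and the leading term there could cancel. *)
Lemma detect_x m : (m.+2 <= n - 1)%N ->
  exists2 u, u \in Lp m.+2 & form u (x (n - m.+2)) != 0.
Proof.
elim: m => [|m IHm] hm.
  apply: (@lower_power_extend 1 _ (y (n - 1))); rewrite ?memvf //.
  have -> : (n - 1 = (n - 2).+1)%N by lia.
  by apply: xy_neq0_from1; lia.
have [|u hu ux] := IHm; first by lia.
apply: (@lower_power_extend m.+2 _ u) => //.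
have um : kills_below u m.+2 by apply: lower_power_kills.
have next : (n - m.+2 = (n - m.+3).+1)%N by lia.
rewrite next in ux.
rewrite (@leading_term _ _ true _ (n - m.+3).+1 um) /=; try by rewrite /level; lia.
  rewrite (@mul_std_eq0 true (n - m.+3) true (n - m.+3).+1); try by rewrite /level; lia.
  by rewrite scaler0 sub0r oppr_eq0 scaler_eq0 negb_or ux xy_neq0_from1 //; lia.
by move=> t k hk; rewrite /level; case: t; lia.
Qed.

(** The upper half, from y_2 to y_(n-1).  Passing from x_1 to y_2 is the only
    step where two terms can cancel, and independence of x_1 y_2 and y_1 y_2
    prevents it. *)
Lemma detect_y j : (j.+2 <= n - 1)%N ->
  exists2 u, u \in Lp (n + j) & form u (y j.+2) != 0.
Proof.
elim: j => [|j IHj] hj.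
  have [|u] := @detect_x (n - 3); first by lia.
  have -> : ((n - 3).+2 = n - 1)%N by lia.
  have -> : (n - (n - 1) = 1)%N by lia.
  move=> hu ux; have -> : (n + 0 = (n - 1).+1)%N by lia.
  apply: (@lower_power_extend _ _ u) => //; first by lia.
  apply: contraNneq ux; rewrite y2_mul // -scaleNr addrC => /(free_pairP _ _ free1).
  by case=> _ ->.
have [|u hu uy] := IHj; first by lia.
rewrite addnS; apply: (@lower_power_extend _ _ u) => //; first by lia.
have um : kills_below u (n + j) by apply: lower_power_kills => //; lia.
rewrite (@leading_term _ _ false _ j.+2 um) /=; try by rewrite /level; lia.
  rewrite (um true) ?scale0r ?subr0; try by rewrite /level; lia.
  rewrite scaler_eq0 negb_or uy mul_antisym oppr_eq0 xy_neq0_from1 //; lia.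
by move=> t k hk; rewrite /level; case: t; lia.
Qed.

Lemma top_power_neq0 : Lp (2 * n - 3) <> 0%VS.
Proof.
have [|u] := @detect_y (n - 3); first by lia.
have -> : (n + (n - 3) = 2 * n - 3)%N by lia.
move=> hu uy L0; case/negP: uy; move: hu; rewrite L0 memv0 => /eqP->.
by rewrite linear0l.
Qed.

End Sufficiency.

End NilpotentPresentation.

Theorem theorem3p30 (F : fieldType) (L : vectType F)
  (form : {biscalar L}) (mul : {bilinear L -> L -> L})
  (n : nat) (x y : nat -> L) (alpha beta : nat -> nat -> nat -> F)
  (hL : is_SAA form mul)
  (hnil : SAA_nilpotent mul)
  (hdim : \dim {:L} = (2 * n)%N) (hn : (8 <= 2 * n)%N)
  (hxy : standard_basis form n x y)
  (hP : nilpotent_presentation form mul n x y alpha beta) :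
  SAA_class mul (2 * n - 3) <->
  (forall i : nat, (2 <= i <= n - 2)%N -> mul (x i) (y i.+1) != 0) /\
  free [:: mul (x 1%N) (y 2%N); mul (y 1%N) (y 2%N)].
Proof.
have n_ge4 : (4 <= n)%N by lia.
have classE := max_classE hL n_ge4 hxy hP.
split=> [/classE Lne0 | [xy_neq0 free1]]; last first.
  exact/classE/(top_power_neq0 hL n_ge4 hxy hP).
split=> [i hi|]; first exact: (x_mul_neq0 hL n_ge4 hxy hP).
exact: (xy1_mul_free hL n_ge4 hxy hP).
Qed.
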